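(* Every commutative ring $A$ has a faithfully flat ring extension $A\subseteq B$ such that $\operatorname{Pic}(B)=0$.
   Context: $\operatorname{Pic}(B)$ denotes the Picard group of $B$: the group of isomorphism classes of finitely generated projective $B$-modules of constant rank $1$ under $\otimes_B$. *)

(* Defs.v *)
From HB Require Import structures.
From mathcomp Require Import all_boot all_order all_algebra.
Set Implicit Arguments. Unset Strict Implicit. Unset Printing Implicit Defensive.
Import Order.TTheory GRing.Theory.
Local Open Scope ring_scope.

(* M (x)_A B is the quotient of the free abelian group Z[M x B] by the
   subgroup generated by the bilinearity / balancing relations.  A formal
   Z-linear combination is a [seq (int * (M * B))]. *)

Section Tensor.
Variables (A B : comPzRingType) (phi : {rmorphism A -> B}) (M : lmodType A).

Definition fcoef (s : seq (int * (M * B))) (x : M * B) : int :=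
  \sum_(p <- s | p.2 == x) p.1.

Inductive tgen : Type :=
  | TAddL of M & M & B
  | TAddR of M & B & B
  | TBal  of A & M & B.

Definition tgen_expand (g : tgen) : seq (int * (M * B)) :=
  match g with
  | TAddL m m' b => [:: (1, (m + m', b)); (-1, (m, b)); (-1, (m', b))]
  | TAddR m b b' => [:: (1, (m, b + b')); (-1, (m, b)); (-1, (m, b'))]
  | TBal a m b => [:: (1, (a *: m, b)); (-1, (m, phi a * b))]
  end%R.

Definition tscale (c : int) (s : seq (int * (M * B))) : seq (int * (M * B)) :=
  [seq (c * p.1, p.2) | p <- s].

Definition tensor_zero (s : seq (int * (M * B))) : Prop :=
  exists r : seq (int * tgen),
    forall x, fcoef s x = fcoef (flatten [seq tscale q.1 (tgen_expand q.2) | q <- r]) x.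

End Tensor.

Definition tmap {A : comPzRingType} (B : comPzRingType) {M N : lmodType A} (f : M -> N)
  (s : seq (int * (M * B))) : seq (int * (N * B)) :=
  [seq (p.1, (f p.2.1, p.2.2)) | p <- s].

Definition flat (A B : comPzRingType) (phi : {rmorphism A -> B}) : Prop :=
  forall (M N : lmodType A) (f : {linear M -> N}), injective f ->
    forall s : seq (int * (M * B)),
      tensor_zero phi (@tmap _ B _ _ f s) -> tensor_zero phi s.

Definition faithfully_flat (A B : comPzRingType) (phi : {rmorphism A -> B}) : Prop :=
  flat phi /\
  forall M : lmodType A,
    (forall s : seq (int * (M * B)), tensor_zero phi s) -> forall m : M, m = 0.

Definition prime_ideal (B : comPzRingType) (P : B -> Prop) : Prop :=
  [/\ P 0, (forall x y, P x -> P y -> P (x + y)),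
      (forall a x, P x -> P (a * x)), ~ P 1 &
      (forall x y, P (x * y) -> P x \/ P y)].

Definition fin_gen (B : comPzRingType) (M : lmodType B) : Prop :=
  exists n (g : {linear 'rV[B]_n -> M}), forall m : M, exists v, g v = m.

Definition projective (B : comPzRingType) (M : lmodType B) : Prop :=
  forall (N P : lmodType B) (g : {linear N -> P}) (f : {linear M -> P}),
    (forall p : P, exists n, g n = p) ->
    exists h : {linear M -> N}, forall m, g (h m) = f m.

(* M_P is free of rank one over B_P, with basis (the image of) m/1,
   unfolding the definition of the localizations M_P and B_P. *)
Definition loc_free_rank1 (B : comPzRingType) (M : lmodType B) (P : B -> Prop) : Prop :=
  exists m : M,
    (forall x : M, exists s b, ~ P s /\ s *: x = b *: m) /\
    (forall b : B, (exists s, ~ P s /\ s *: (b *: m) = 0) ->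
                   exists s, ~ P s /\ s * b = 0).

Definition constant_rank1 (B : comPzRingType) (M : lmodType B) : Prop :=
  forall P : B -> Prop, prime_ideal P -> loc_free_rank1 M P.

Definition Pic_trivial (B : comPzRingType) : Prop :=
  forall M : lmodType B, fin_gen M -> projective M -> constant_rank1 M ->
    exists f : {linear M -> 'rV[B]_1}, bijective f.

(* Main.v *)
(** The extension is the Nagata ring B = S^-1 A[X], where S is the set of
    primitive polynomials, i.e. those whose coefficients do not all lie in one
    prime ideal.

    A projective B-module of rank one is the image of an idempotent matrix e
    whose 2x2 minors vanish and whose entries do not all lie in one prime.  For
    such a matrix, (e v)(w e) = (w e v) e for every column v and row w, so the
    module is free as soon as w e v is a unit for some v and w.  Writing
    e_ij = p_ij / d and taking w_i = X^(N n i), v_j = X^(N j) with N larger than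
    the degrees of the p_ij, the numerator of w e v lists the coefficients of all
    the p_ij without overlap, so it is primitive, hence a unit of B.

    For faithful flatness, the sum of the m_i (x) p_i/d is zero iff some primitive
    u kills the polynomial with coefficients in M given by the sum of the p_i m_i.
    To detect the nonvanishing of a tensor, M[X] is realized inside E[X], where E
    is the idealization of M. *)
Require Import Defs.
From HB Require Import structures.
From mathcomp Require Import all_boot all_order all_algebra.
From mathcomp Require Import ring_quotient generic_quotient.
From mathcomp Require Import boolp classical_sets functions.
From mathcomp Require Import ring.
Set Implicit Arguments. Unset Strict Implicit. Unset Printing Implicit Defensive.
Import GRing.Theory.
Local Open Scope ring_scope.
Local Open Scope quotient_scope.

(** * Localization of a commutative ring *)

Record mulset (R : comPzRingType) := MulSet {
  mulset_pred :> pred R;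
  mulset1 : mulset_pred 1;
  mulsetM : forall x y, mulset_pred x -> mulset_pred y -> mulset_pred (x * y) }.

Section Localization.
Variables (R : comPzRingType) (S : mulset R).

Definition denom := {x : R | S x}.

Definition denom1 : denom := exist _ 1 (mulset1 S).
Definition denomM (s t : denom) : denom :=
  exist _ (sval s * sval t) (mulsetM (valP s) (valP t)).

Definition loc_equiv (x y : R * denom) :=
  `[< exists u : denom, sval u * (x.1 * sval y.2) = sval u * (y.1 * sval x.2) >].

Lemma loc_equiv_refl : reflexive loc_equiv.
Proof. by move=> x; apply/asboolP; exists denom1. Qed.

Lemma loc_equiv_sym : symmetric loc_equiv.
Proof. by move=> x y; apply/asboolP/asboolP => -[u ux]; exists u. Qed.

Lemma loc_equiv_trans : transitive loc_equiv.
Proof.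
move=> y x z /asboolP[u ux] /asboolP[v vy]; apply/asboolP.
exists (denomM (denomM u v) y.2) => /=.
transitivity (sval v * sval z.2 * (sval u * (x.1 * sval y.2))); first by ring.
rewrite ux; transitivity (sval u * sval x.2 * (sval v * (y.1 * sval z.2))); first by ring.
by rewrite vy; ring.
Qed.

Canonical loc_equiv_rel :=
  EquivRel loc_equiv loc_equiv_refl loc_equiv_sym loc_equiv_trans.

Definition loc := {eq_quot loc_equiv}.
HB.instance Definition _ : EqQuotient _ loc_equiv loc := EqQuotient.on loc.
HB.instance Definition _ := Choice.on loc.

Definition fr (a : R) (s : denom) : loc := \pi_loc (a, s).

Lemma fr_eq a s b t :
  fr a s = fr b t <-> exists u : denom, sval u * (a * sval t) = sval u * (b * sval s).
Proof. by split=> [/eqmodP/asboolP|h] //; apply/eqmodP/asboolP. Qed.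

Lemma fr_surj (b : loc) : exists a s, b = fr a s.
Proof. by exists (repr b).1, (repr b).2; rewrite /fr -surjective_pairing reprK. Qed.

Definition loc_add (x y : loc) : loc := let: (a, s) := repr x in
  let: (b, t) := repr y in fr (a * sval t + b * sval s) (denomM s t).
Definition loc_mul (x y : loc) : loc := let: (a, s) := repr x in
  let: (b, t) := repr y in fr (a * b) (denomM s t).
Definition loc_opp (x : loc) : loc := let: (a, s) := repr x in fr (- a) s.

Lemma fr_repr a s : exists u : denom,
  sval u * ((repr (fr a s)).1 * sval s) = sval u * (a * sval (repr (fr a s)).2).
Proof. by apply/fr_eq; rewrite /fr -surjective_pairing reprK. Qed.

Lemma loc_addE a s b t :
  loc_add (fr a s) (fr b t) = fr (a * sval t + b * sval s) (denomM s t).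
Proof.
rewrite /loc_add; have [u] := fr_repr a s; have [v] := fr_repr b t.
case: (repr _) => b' t'; case: (repr _) => a' s' /= vb ua.
apply/fr_eq; exists (denomM u v) => /=.
transitivity (sval v * sval t' * sval t * (sval u * (a' * sval s))
  + sval u * sval s' * sval s * (sval v * (b' * sval t))); first by ring.
by rewrite ua vb; ring.
Qed.

Lemma loc_mulE a s b t : loc_mul (fr a s) (fr b t) = fr (a * b) (denomM s t).
Proof.
rewrite /loc_mul; have [u] := fr_repr a s; have [v] := fr_repr b t.
case: (repr _) => b' t'; case: (repr _) => a' s' /= vb ua.
apply/fr_eq; exists (denomM u v) => /=.
transitivity ((sval u * (a' * sval s)) * (sval v * (b' * sval t))); first by ring.
by rewrite ua vb; ring.
Qed.

Lemma loc_oppE a s : loc_opp (fr a s) = fr (- a) s.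
Proof.
rewrite /loc_opp; have [u] := fr_repr a s.
case: (repr _) => a' s' /= ua; apply/fr_eq; exists u.
by rewrite !mulNr !mulrN ua.
Qed.

Ltac elimfr x := let a := fresh "a" in let s := fresh "s" in
  have [a [s ->]] := fr_surj x.
Ltac frring := apply/fr_eq; exists denom1; rewrite /=; ring.

Lemma loc_addA : associative loc_add.
Proof. by move=> x y z; elimfr x; elimfr y; elimfr z; rewrite !loc_addE; frring. Qed.
Lemma loc_addC : commutative loc_add.
Proof. by move=> x y; elimfr x; elimfr y; rewrite !loc_addE; frring. Qed.
Lemma loc_add0 : left_id (fr 0 denom1) loc_add.
Proof. by move=> x; elimfr x; rewrite !loc_addE; frring. Qed.
Lemma loc_addN : left_inverse (fr 0 denom1) loc_opp loc_add.
Proof. by move=> x; elimfr x; rewrite loc_oppE loc_addE; frring. Qed.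

HB.instance Definition _ :=
  GRing.isZmodule.Build loc loc_addA loc_addC loc_add0 loc_addN.

Lemma loc_mulA : associative loc_mul.
Proof. by move=> x y z; elimfr x; elimfr y; elimfr z; rewrite !loc_mulE; frring. Qed.
Lemma loc_mulC : commutative loc_mul.
Proof. by move=> x y; elimfr x; elimfr y; rewrite !loc_mulE; frring. Qed.
Lemma loc_mul1 : left_id (fr 1 denom1) loc_mul.
Proof. by move=> x; elimfr x; rewrite !loc_mulE; frring. Qed.
Lemma loc_mulDl : left_distributive loc_mul loc_add.
Proof.
by move=> x y z; elimfr x; elimfr y; elimfr z; rewrite !(loc_mulE, loc_addE); frring.
Qed.

HB.instance Definition _ :=
  GRing.Zmodule_isComPzRing.Build loc loc_mulA loc_mulC loc_mul1 loc_mulDl.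

Lemma frD a s b t : fr a s + fr b t = fr (a * sval t + b * sval s) (denomM s t).
Proof. exact: loc_addE. Qed.
Lemma frM a s b t : fr a s * fr b t = fr (a * b) (denomM s t).
Proof. exact: loc_mulE. Qed.
Lemma fr0 s : fr 0 s = 0.
Proof. by rewrite -[RHS]/(fr 0 denom1); apply/fr_eq; exists denom1; rewrite /= !mul0r. Qed.
Lemma frs s : fr (sval s) s = 1.
Proof. by rewrite -[RHS]/(fr 1 denom1); apply/fr_eq; exists denom1; rewrite /=; ring. Qed.

Lemma fr_eq0 a s : fr a s = 0 <-> exists u : denom, sval u * a = 0.
Proof.
rewrite -(fr0 denom1); split=> [/fr_eq[u]|[u ua]]; first by rewrite /= mulr1 mul0r mulr0; exists u.
by apply/fr_eq; exists u; rewrite mulrA ua !mul0r mulr0.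
Qed.

Lemma fr_cancel a s t : fr (sval t * a) (denomM t s) = fr a s.
Proof. by frring. Qed.

Definition toloc a := fr a denom1.

Lemma toloc_zmod_morphism : zmod_morphism toloc.
Proof.
move=> a b; rewrite /toloc (_ : - fr b _ = fr (- b) denom1); last exact: loc_oppE.
by rewrite frD; frring.
Qed.
HB.instance Definition _ := GRing.isZmodMorphism.Build R loc toloc toloc_zmod_morphism.

Lemma toloc_monoid_morphism : monoid_morphism toloc.
Proof. by split=> [|a b]; rewrite /toloc ?frM; [exact: frs denom1 | frring]. Qed.
HB.instance Definition _ := GRing.isMonoidMorphism.Build R loc toloc toloc_monoid_morphism.

Lemma tolocM a b s : toloc a * fr b s = fr (a * b) s.
Proof. by rewrite /toloc frM; frring. Qed.
Lemma frE a s : fr a s = toloc a * fr 1 s.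
Proof. by rewrite tolocM mulr1. Qed.

Lemma common_denom (r : seq loc) :
  exists d : denom, forall b, b \in r -> exists a, b = fr a d.
Proof.
elim: r => [|b r [d hd]]; first by exists denom1.
have [a [s ->]] := fr_surj b; exists (denomM s d) => c.
rewrite inE => /predU1P[->|/hd[p ->]].
  by exists (a * sval d); frring.
by exists (sval s * p); rewrite fr_cancel.
Qed.

End Localization.

(** * Functoriality of localization *)

Section LocMap.
Variables (R R' : comPzRingType) (f : {rmorphism R -> R'}) (S : mulset R).

(** Taking exactly the image of [S] means that any denominator annihilating something in the target
    is the image of one in [S]; the zero criterion for tensors relies on this. *)
Definition mulset_image : mulset R'.
exists (fun y => `[< exists2 x, S x & y = f x >]).
- by apply/asboolP; exists 1; rewrite ?rmorph1 ?mulset1.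
- move=> _ _ /asboolP[x Sx ->] /asboolP[y Sy ->]; apply/asboolP.
  by exists (x * y); rewrite ?rmorphM ?mulsetM.
Defined.

Lemma mem_mulset_image (s : denom S) : mulset_image (f (sval s)).
Proof. by apply/asboolP; exists (sval s); first exact: (valP s). Qed.

Definition denom_map (s : denom S) : denom mulset_image :=
  exist _ (f (sval s)) (mem_mulset_image s).

Definition loc_map (b : loc S) : loc mulset_image :=
  let: (a, s) := repr b in fr (f a) (denom_map s).

Lemma loc_mapE a s : loc_map (fr a s) = fr (f a) (denom_map s).
Proof.
rewrite /loc_map; have [u] := fr_repr a s; case: (repr _) => a' t /= ua.
by apply/fr_eq; exists (denom_map u); rewrite /= -!rmorphM ua.
Qed.

Lemma loc_map_zmod_morphism : zmod_morphism loc_map.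
Proof.
move=> x y; have [a [s ->]] := fr_surj x; have [b [t ->]] := fr_surj y.
rewrite [- fr b t]loc_oppE frD !loc_mapE [- fr (f b) _]loc_oppE frD.
by apply/fr_eq; exists (denom1 _); rewrite /= rmorphD !rmorphM rmorphN.
Qed.
HB.instance Definition _ :=
  GRing.isZmodMorphism.Build (loc S) (loc mulset_image) loc_map loc_map_zmod_morphism.

Lemma loc_map_monoid_morphism : monoid_morphism loc_map.
Proof.
split=> [|x y]; first by rewrite -(frs (denom1 S)) loc_mapE (frs (denom_map _)).
have [a [s ->]] := fr_surj x; have [b [t ->]] := fr_surj y.
by rewrite frM !loc_mapE frM; apply/fr_eq; exists (denom1 _); rewrite /= !rmorphM.
Qed.
HB.instance Definition _ :=
  GRing.isMonoidMorphism.Build (loc S) (loc mulset_image) loc_map loc_map_monoid_morphism.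

End LocMap.

(** * Prime ideals and primitive polynomials *)

(** Otherwise Zorn's lemma gives a maximal proper ideal containing [I], and it is prime. Below, [I]
    is mostly an annihilator, which makes this a local-to-global principle. *)
Lemma prime_avoidance_unit (R : comPzRingType) (I : R -> Prop) :
  I 0 -> (forall x y, I x -> I y -> I (x + y)) -> (forall a x, I x -> I (a * x)) ->
  (forall P, prime_ideal P -> exists2 x, I x & ~ P x) -> I 1.
Proof.
move=> I0 ID IM avoid; apply: contrapT => I1.
pose ideal (J : set R) := [/\ J 0, (forall x y, J x -> J y -> J (x + y)),
  (forall a x, J x -> J (a * x)) & ~ J 1].
(* Joining [I] to each [X] handles the empty chain: its union is empty, and [I] itself is a proper
   ideal. *)
pose good := [set X : set R | ideal (I `|` X)]%classic.
have [F Fgood Ftot|A [[A0 AD AM A1] Amax]] := @Zorn_bigcup R good.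
  split=> [|x y [Ix|[X FX Xx]] [Iy|[Y FY Yy]]|a x [Ix|[X FX Xx]]|[//|[X FX X1]]].
  - by left.
  - by left; exact: ID.
  - by have [_ D _ _] := Fgood _ FY; have [] := D x y (or_introl Ix) (or_intror Yy);
      [left|right; exists Y].
  - by have [_ D _ _] := Fgood _ FX; have [] := D x y (or_intror Xx) (or_introl Iy);
      [left|right; exists X].
  - have [XY|YX] := Ftot _ _ FX FY.
      by have [_ D _ _] := Fgood _ FY; have [] := D x y (or_intror (XY _ Xx)) (or_intror Yy);
        [left|right; exists Y].
    by have [_ D _ _] := Fgood _ FX; have [] := D x y (or_intror Xx) (or_intror (YX _ Yy));
      [left|right; exists X].
  - by left; exact: IM.
  - by have [_ _ M _] := Fgood _ FX; have [] := M a x (or_intror Xx); [left|right; exists X].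
  - by have [_ _ _ N] := Fgood _ FX; apply: N; right.
pose J := (I `|` A)%classic.
have Jmax (K : set R) : (J `<=` K)%classic -> forall x, K x -> ~ J x ->
    K 0 -> (forall x y, K x -> K y -> K (x + y)) -> (forall a x, K x -> K (a * x)) -> K 1.
  move=> JK x Kx Jx K0 KD KM; apply: contrapT => K1.
  apply: (Amax K); last first.
    by rewrite /good /= setUidr // => y Iy; apply: JK; left.
  split=> [y Ay|KA]; first by apply: JK; right.
  by apply: Jx; right; exact: KA.
have [|x Ix []] := avoid J; [|by left].
split=> // x y Jxy; have [Jx|Jx] := pselect (J x); first by left.
(* For [x] outside [J], the ideal [J + (x)] contains 1 by maximality. From [1 = j + a * x] follows
   [y = y * j + a * (x * y)], which lies in [J]. *)
right; pose K : set R := fun z => exists2 j, J j & exists a, z = j + a * x.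
have [|||||j Jj [a ja]] := Jmax K _ x _ Jx _ _ _.
- by move=> j Jj; exists j => //; exists 0; rewrite mul0r addr0.
- by exists 0 => //; exists 1; rewrite mul1r add0r.
- by exists 0 => //; exists 0; rewrite mul0r add0r.
- move=> _ _ [j Jj [a ->]] [k Jk [b ->]].
  by exists (j + k); [exact: AD|exists (a + b); ring].
- move=> a _ [j Jj [b ->]].
  by exists (a * j); [exact: AM|exists (a * b); ring].
rewrite -[y]mul1r ja (_ : _ * y = y * j + a * (x * y)); last by ring.
by apply: AD; exact: AM.
Qed.

(** * Extension of primes to a localization *)

Section LocPrime.
Variables (R : comPzRingType) (S : mulset R) (P : R -> Prop).
Hypotheses (Pprime : prime_ideal P) (PS : forall s : denom S, ~ P (sval s)).

Lemma prime_ideal_loc :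
  prime_ideal (fun b : loc S => exists2 a, P a & exists s, b = fr a s).
Proof.
have [P0 PD PM P1 PX] := Pprime.
split.
- by exists 0 => //; exists (denom1 S); rewrite fr0.
- move=> _ _ [a Pa [s ->]] [b Pb [t ->]]; rewrite frD.
  exists (a * sval t + b * sval s); last by eexists.
  by rewrite mulrC [b * _]mulrC; apply: PD; exact: PM.
- move=> x _ [a Pa [s ->]]; have [b [t ->]] := fr_surj x; rewrite frM.
  by exists (b * a); [exact: PM|eexists].
- move=> [a Pa [s]]; rewrite -(frs (denom1 S)) => /fr_eq[u]; rewrite /= mul1r mulr1 => us.
  have /PX[] : P (sval u * sval s) by rewrite us; exact: PM.
  + exact: PS.
  + exact: PS.
- move=> x y; have [a [s ->]] := fr_surj x; have [b [t ->]] := fr_surj y.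
  rewrite frM => -[c Pc [r /fr_eq[u /= us]]].
  have : P (sval u * (a * b * sval r)) by rewrite us mulrCA mulrC; exact: PM.
  case/PX => [/PS//|/PX[/PX[Pa|Pb]|/PS//]].
    by left; exists a => //; exists s.
  by right; exists b => //; exists t.
Qed.

End LocPrime.

(** * Primes of the form P[X] and primitive polynomials *)

Section Primitive.
Variable A : comNzRingType.

Definition coefs_in (P : A -> Prop) (p : {poly A}) := forall i, P p`_i.

(** Gauss's argument: if [i] and [j] are the least indices with [p_i] and [q_j] outside [P], every
    term of the coefficient of index [i + j] of [p * q] other than [p_i * q_j] lies in [P]. *)
Lemma prime_ideal_coefs_in P : prime_ideal P -> prime_ideal (coefs_in P).
Proof.
case=> P0 PD PM P1 PX; have Psum n (F : 'I_n -> A) : (forall i, P (F i)) -> P (\sum_i F i).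
  by move=> PF; elim/big_ind: _.
split.
- by move=> i; rewrite coef0.
- by move=> p q Pp Pq i; rewrite coefD; exact: PD.
- by move=> p q Pq i; rewrite coefM; apply: Psum => j; exact: PM.
- by move/(_ 0%N); rewrite coef1.
- move=> p q Ppq; apply: contrapT => /not_orP[].
  move=> /existsNP[i0 Pi0] /existsNP[j0 Pj0].
  have [i /asboolP Pi imin] := @ex_minnP (fun i => `[< ~ P p`_i >]) (ex_intro _ i0 (asboolT Pi0)).
  have [j /asboolP Pj jmin] := @ex_minnP (fun i => `[< ~ P q`_i >]) (ex_intro _ j0 (asboolT Pj0)).
  have lti : (i < (i + j).+1)%N by rewrite ltnS leq_addr.
  have /= := Ppq (i + j)%N; rewrite coefM (bigD1 (Ordinal lti)) //= addKn.
  set r := \sum_(_ < _ | _) _ => Pr.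
  have Pr' : P r.
    rewrite /r; elim/big_ind: _ => // k kni.
    have [ki|ik] := ltnP k i.
      rewrite mulrC; apply: PM; apply: contrapT => Pk.
      by have := imin k (asboolT Pk); rewrite leqNgt ki.
    have {}ik : (i < k)%N by rewrite ltn_neqAle ik andbT eq_sym; exact: kni.
    apply: PM; apply: contrapT => Pk.
    have := jmin _ (asboolT Pk); rewrite leq_subRL; last by rewrite -ltnS.
    by rewrite leq_add2r leqNgt ik.
  have : P (p`_i * q`_j).
    by rewrite -[_ * _](addrK r) -[- r]mulN1r; apply: PD => //; exact: PM.
  by case/PX.
Qed.

Definition primitive (p : {poly A}) := forall P, prime_ideal P -> ~ coefs_in P p.

Lemma primitive1 : `[< primitive 1 >].
Proof. by apply/asboolP => P /prime_ideal_coefs_in[]. Qed.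

Lemma primitiveM p q : `[< primitive p >] -> `[< primitive q >] -> `[< primitive (p * q) >].
Proof.
move=> /asboolP Sp /asboolP Sq; apply/asboolP => P Pp.
have [_ _ _ _ PX] := prime_ideal_coefs_in Pp.
by move/PX => [|]; [exact: Sp|exact: Sq].
Qed.

Definition primitives : mulset {poly A} :=
  @MulSet {poly A} (fun p => `[< primitive p >]) primitive1 primitiveM.

Lemma denom_primitive (s : denom primitives) : primitive (sval s).
Proof. exact: (asboolW (valP s)). Qed.

(** Each prime misses some coefficient of [p], hence an element of [I]. With [I] the annihilator of
    an element, this shows that an element killed by every coefficient of [p] is zero. *)
Lemma primitive_unit (p : {poly A}) (I : A -> Prop) : primitive p ->
  I 0 -> (forall x y, I x -> I y -> I (x + y)) -> (forall a x, I x -> I (a * x)) ->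
  coefs_in I p -> I 1.
Proof.
move=> prim I0 ID IM Ip; apply: prime_avoidance_unit => // P /prim/existsNP[i Pi].
by exists p`_i.
Qed.

End Primitive.

(** * Projective modules of rank one *)

Lemma prime_ideal_prod (R : comPzRingType) (P : R -> Prop) (I : finType) (F : I -> R) :
  prime_ideal P -> (forall i, ~ P (F i)) -> ~ P (\prod_i F i).
Proof. by case=> _ _ _ P1 PX PF; elim/big_ind: _ => // x y Px Py /PX[]. Qed.

Section RankOne.
Variables (B : comPzRingType) (M : lmodType B) (n : nat).
Variables (g : {linear 'rV[B]_n -> M}) (h : {linear M -> 'rV[B]_n}).
Hypothesis gK : cancel h g.
Hypothesis Mrank1 : constant_rank1 M.

Let x i := g (delta_mx 0 i).
(** The matrix of the idempotent [h \o g], acting on rows from the right; [h] identifies [M] with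
    its row space. *)
Let e := \matrix_(i, j) h (x i) 0 j.

Lemma section_mulmx v : h (g v) = v *m e.
Proof.
rewrite {1}[v]row_sum_delta !linear_sum; apply/rowP => j.
rewrite summxE mxE; apply: eq_bigr => i _.
by rewrite !linearZ !mxE.
Qed.

(** The local basis [m] at [P], with one denominator for all generators: the product of the separate
    ones. In the last clause, [t * c = 0] with [t] outside [P] forces [c] into [P]. *)
Lemma local_generator P : prime_ideal P -> exists m s (b : 'I_n -> B),
  [/\ ~ P s, forall i, s *: x i = b i *: m &
      forall b, (exists s, ~ P s /\ s *: (b *: m) = 0) -> P b].
Proof.
move=> Pp; have [m [mgen mfree]] := Mrank1 Pp; have [P0 PD PM P1 PX] := Pp.
have /fin_all_exists[s /fin_all_exists[b sb]] i := mgen (x i).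
exists m, (\prod_i s i), (fun i => \prod_(j | j != i) s j * b i); split.
- by apply: prime_ideal_prod => // i; case: (sb i).
- by move=> i; rewrite (bigD1 i) //= mulrC -!scalerA; case: (sb i) => _ ->.
- move=> c /mfree[t [Pt tc]].
  by have : P (t * c) by [rewrite tc]; case/PX.
Qed.

(** Near each prime, [s] times row [u] of [e] is [b u] times the single row [h m]. So [s * s], which
    lies outside [P], kills the minor, and the annihilator of the minor contains 1. *)
Lemma section_minors i j k l : e i j * e k l = e i l * e k j.
Proof.
pose I b := b * (e i j * e k l - e i l * e k j) = 0.
have : I 1; last by rewrite /I mul1r => /eqP; rewrite subr_eq0 => /eqP.
apply: prime_avoidance_unit; rewrite /I.
- by rewrite mul0r.
- by move=> b c bI cI; rewrite mulrDl bI cI addr0.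
- by move=> a b bI; rewrite -mulrA bI mulr0.
move=> P Pp; have [m [s [b [Ps sx _]]]] := local_generator Pp.
have se u v : s * e u v = b u * h m 0 v.
  by rewrite mxE; have := congr1 (fun m => h m 0 v) (sx u); rewrite !linearZ !mxE.
exists (s * s); last by have [_ _ _ _ PX] := Pp => /PX[].
rewrite mulrBr (_ : s * s * (e i j * e k l) = (s * e i j) * (s * e k l)); last by ring.
rewrite (_ : s * s * (e i l * e k j) = (s * e i l) * (s * e k j)); last by ring.
by rewrite !se; ring.
Qed.

(** If [P] contained all entries, [e] would vanish modulo [P]. Expressing the generators through [e]
    then puts every [b i] in [P], and expressing [m] through the generators puts [s] in [P]. *)
Lemma section_entry P : prime_ideal P -> exists i j, ~ P (e i j).
Proof.
move=> Pp; apply: contrapT => eP.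
have {}eP i j : P (e i j) by apply: contrapT => Pe; apply: eP; exists i, j.
have [m [s [b [Ps sx mfree]]]] := local_generator Pp.
have [P0 PD PM P1 PX] := Pp.
have Psum (F : 'I_n -> B) : (forall i, P (F i)) -> P (\sum_i F i).
  by move=> PF; elim/big_ind: _.
(* The coefficient of a multiple of [m] is determined modulo [P]. *)
have PbB c d : c *: m = d *: m -> P d -> P c.
  move=> cd Pd; rewrite -[c](subrK d); apply: PD => //; apply: mfree.
  by exists 1; split=> //; rewrite scale1r scalerBl cd subrr.
have msum (v : 'rV[B]_n) : g v = \sum_i v 0 i *: x i.
  by rewrite {1}[v]row_sum_delta linear_sum; apply: eq_bigr => i _; rewrite linearZ.
apply: Ps; apply: (PbB _ (\sum_i h m 0 i * b i)).
  rewrite -{1}[m]gK msum scaler_sumr scaler_suml; apply: eq_bigr => i _.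
  by rewrite scalerA mulrC -!scalerA sx.
(* Here [b i] is shown to lie in [P]: [b i *: m = s *: x i], and [x i] is the sum of the
   [e i j *: x j]. *)
apply: (Psum) => i; apply: (PM); apply: (PbB _ (\sum_j e i j * b j)); last first.
  by apply: Psum => j; rewrite mulrC; exact: PM.
rewrite -sx -[x i]gK msum scaler_sumr scaler_suml; apply: eq_bigr => j _.
by rewrite scalerA mulrC -!scalerA sx mxE.
Qed.

(** The maps [y -> h y *m v] and [c -> (u' * c) *: g w] are mutually inverse: one composite is
    multiplication by [u' * u = 1], the other is the identity because [e] has rank one. *)
Lemma free_of_unit_value (w : 'rV[B]_n) (v : 'cV[B]_n) (u' : B) :
  u' * (w *m e *m v) 0 0 = 1 -> exists f : {linear M -> 'rV[B]_1}, bijective f.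
Proof.
set u := (_ *m v) 0 0 => u'u.
pose f y := h y *m v.
have flin : linear f by move=> a y z; rewrite /f linearP mulmxDl scalemxAl.
pose fL : {linear M -> 'rV[B]_1} := HB.pack f (GRing.isLinear.Build _ _ _ _ f flin).
have fgw : f (g w) = u%:M by rewrite /f section_mulmx [LHS]mx11_scalar.
exists fL; exists (fun c : 'rV[B]_1 => (u' * c 0 0) *: g w) => [y|c] /=; last first.
  rewrite /f linearZ -scalemxAl -/(f _) fgw [RHS]mx11_scalar.
  by rewrite scale_scalar_mx -mulrA mulrC -mulrA [u * _]mulrC u'u mulr1.
have hgw a : h (a *: g w) = a *: (w *m e) by rewrite linearZ section_mulmx.
apply: (can_inj gK); rewrite hgw -scalerA.
have hy : h y = h y *m e by rewrite -section_mulmx gK.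
suff -> : f y 0 0 *: (w *m e) = u *: h y by rewrite scalerA u'u scale1r.
have -> : f y 0 0 *: (w *m e) = f y *m (w *m e).
  by rewrite [f y in RHS]mx11_scalar mul_scalar_mx.
rewrite /f {}hy -!mulmxA scalemxAr; congr (h y *m _).
(* What remains is [e *m v *m w *m e = u *: e]; termwise, the minors give
   [E i k * E l j = E i j * E l k]. *)
rewrite /u; move: e section_minors => E minors.
apply/matrixP => i j; rewrite !mxE big_distrl /=; apply: eq_bigr => k _.
rewrite !mxE big_ord1 !mxE !big_distrl /= !big_distrr /=; apply: eq_bigr => l _.
rewrite (_ : _ * (_ * (_ * _)) = w 0 l * v k 0 * (E i k * E l j)); last by ring.
by rewrite minors; ring.
Qed.

End RankOne.

(** * Triviality of the Picard group *)

(** The summand of [j] occupies only the [N] degrees starting at [N * c j], and these blocks are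
    disjoint for distinct [j]. *)
Lemma coef_spread (A : comNzRingType) (I : finType) (c : I -> nat) (p : I -> {poly A}) N i k :
  injective c -> (forall j, size (p j) <= N)%N -> (k < N)%N ->
  (\sum_j 'X^(N * c j) * p j)`_(N * c i + k) = (p i)`_k.
Proof.
move=> cinj sp kN; rewrite coef_sum (bigD1 i) //= coefXnM ltnNge leq_addr addKn.
rewrite big1 ?addr0 // => j ji; rewrite coefXnM; case: ltnP => // le.
have {ji}ji : c j != c i by apply: contra_neq ji => /cinj.
rewrite nth_default //; apply: leq_trans (sp j) _.
have lt : (c j < c i)%N.
  rewrite ltn_neqAle ji leqNgt; apply/negP => lt.
  have : (N * (c i).+1 <= N * c j)%N by rewrite leq_mul2l lt orbT.
  by rewrite mulnS addnC leqNgt (leq_ltn_trans le) // ltn_add2l.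
rewrite leq_subRL //; apply: leq_trans (leq_addr _ _).
by rewrite addnC -mulnS leq_mul2l lt orbT.
Qed.

Lemma Pic_trivial_primitives (A : comNzRingType) : Pic_trivial (loc (primitives A)).
Proof.
move=> M [n [g gsurj]] Mproj Mrank1.
have [h hK] := Mproj _ _ g idfun gsurj.
have {}hK : cancel h g := hK.
pose e i j := h (g (delta_mx 0 i)) 0 j.
have [d dP] := common_denom [seq e ij.1 ij.2 | ij : 'I_n * 'I_n].
have /fin_all_exists[p ep] (ij : 'I_n * 'I_n) : exists p, e ij.1 ij.2 = fr p d.
  exact/dP/(codom_f (fun ij => e ij.1 ij.2)).
pose N := (\sum_ij size (p ij))%N.
have pN ij : (size (p ij) <= N)%N by rewrite /N (bigD1 ij) //= leq_addr.
(* With this row-major numbering, ['X^(N * c (i, j))] factors as ['X^(N * (n * i)) * 'X^(N * j)],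
   the product of the entries [w_i] and [v_j] below. *)
pose c (ij : 'I_n * 'I_n) := (n * ij.1 + ij.2)%N.
have cinj : injective c.
  move=> [i j] [k l]; rewrite /c /= => eq_c.
  have n0 : (0 < n)%N by exact: leq_ltn_trans (ltn_ord i).
  have := congr1 (fun q => divn q n) eq_c; have := congr1 (fun q => modn q n) eq_c.
  rewrite ![(n * _)%N]mulnC !modnMDl !modn_small // !divnMDl // !divn_small // !addn0.
  by move=> /val_inj-> /val_inj->.
pose F := \sum_ij 'X^(N * c ij) * p ij.
(* A prime [P] containing all coefficients of [F] contains those of every [p ij]. All entries of the
   matrix then lie in the extension of P[X] to the localization, which is prime since P[X] contains
   no primitive polynomial; this contradicts [section_entry]. *)
have Fprim : primitive F.
  move=> P Pprime PF.
  have Qprime := prime_ideal_loc (prime_ideal_coefs_in Pprime)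
    (fun s => @denom_primitive A s P Pprime).
  have [i [j]] := section_entry hK Mrank1 Qprime; rewrite mxE; apply.
  exists (p (i, j)); last by exists d; exact: (ep (i, j)).
  move=> k; have [kN|Nk] := ltnP k N.
    by rewrite -(coef_spread _ cinj pN kN); exact: PF.
  by rewrite nth_default; [case: Pprime | exact: leq_trans (pN _) Nk].
pose f : denom (primitives A) := exist _ F (asboolT Fprim).
pose w : 'rV[loc (primitives A)]_n := \row_i toloc _ 'X^(N * (n * i)).
pose v : 'cV[loc (primitives A)]_n := \col_j toloc _ 'X^(N * j).
(* The value [w e v] is [F / d], with inverse [d / F]. *)
apply: (@free_of_unit_value _ _ _ g h hK Mrank1 w v (fr (sval d) f)).
rewrite (_ : (_ *m v) 0 0 = fr F d).
  by rewrite frM -(frs (denom1 (primitives A))); apply/fr_eq; exists (denom1 _); rewrite /=; ring.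
rewrite frE /F rmorph_sum mulr_suml /= mxE.
under [LHS]eq_bigr => j _ do rewrite mxE mulr_suml.
rewrite exchange_big pair_big; apply: eq_bigr => ij _ /=.
rewrite !mxE [h _ _ _](ep ij) frE mulnDr exprD !rmorphM /=; ring.
Qed.

(** * Vanishing of formal tensors *)

Section TensorEval.
Variables (A B : comPzRingType) (phi : {rmorphism A -> B}) (M : lmodType A).
Implicit Types (s t : seq (int * (M * B))).

Definition balanced (G : zmodType) (f : M -> B -> G) :=
  [/\ forall m m' b, f (m + m') b = f m b + f m' b,
      forall m b b', f m (b + b') = f m b + f m b' &
      forall a m b, f (a *: m) b = f m (phi a * b)].

Definition teval (G : zmodType) (f : M -> B -> G) s :=
  \sum_(p <- s) f p.2.1 p.2.2 *~ p.1.

Lemma teval_fcoef (G : zmodType) (f : M -> B -> G) s (r : seq (M * B)) :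
  uniq r -> {subset map snd s <= r} -> teval f s = \sum_(x <- r) f x.1 x.2 *~ fcoef s x.
Proof.
move=> r_uniq; elim: s => [|p s IHs] sr.
  by rewrite /teval big_nil big1 // => x _; rewrite /fcoef big_nil.
rewrite /teval big_cons -/(teval f s) IHs; last by move=> x xs; apply: sr; rewrite inE xs orbT.
under [RHS]eq_bigr => x _.
  rewrite /fcoef big_cons -/(fcoef s x) (_ : (if _ then _ else _) =
    (if p.2 == x then p.1 else 0) + fcoef s x); last by case: ifP; rewrite ?add0r.
  rewrite mulrzDr; over.
rewrite big_split; congr (_ + _); rewrite (bigD1_seq p.2) //=; last by apply: sr; rewrite inE eqxx.
by rewrite eqxx big1 ?addr0 // => x /negPf; rewrite eq_sym => ->.
Qed.

Lemma eq_teval (G : zmodType) (f : M -> B -> G) s t :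
  fcoef s =1 fcoef t -> teval f s = teval f t.
Proof.
move=> st; pose r := undup (map snd (s ++ t)).
rewrite !(@teval_fcoef _ _ _ r) ?undup_uniq //; first by apply: eq_bigr => x _; rewrite st.
  by move=> x; rewrite mem_undup map_cat mem_cat orbC => ->.
by move=> x; rewrite mem_undup map_cat mem_cat => ->.
Qed.

Lemma teval_tensor_zero (G : zmodType) (f : M -> B -> G) s :
  balanced f -> tensor_zero phi s -> teval f s = 0.
Proof.
move=> [fDl fDr fZ] [r /eq_teval->].
rewrite /teval big_flatten big_map big1 // => -[c g] _; rewrite big_map /=.
under eq_bigr => p _ do rewrite mulrC mulrzA.
rewrite -mulrz_suml (_ : \sum_(_ <- _) _ = 0) ?mul0rz //.
by case: g => [m m' b|m b b'|a m b]; rewrite !big_cons big_nil /= !mulrN1z mulr1z ?fDl ?fDr ?fZ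
  ?addr0 -?opprD ?subrr.
Qed.

(** Coefficient functions, unlike lists, form a group, in which the relations are a subgroup. *)
Definition relations : pred (M * B -> int) := fun F => `[< exists r : seq (int * @tgen A B M),
  forall x, F x = fcoef (flatten [seq tscale q.1 (tgen_expand phi q.2) | q <- r]) x >].

Lemma fcoef_cat s t x : fcoef (s ++ t) x = fcoef s x + fcoef t x.
Proof. by rewrite /fcoef big_cat. Qed.

Lemma fcoef_tscale c s x : fcoef (tscale c s) x = c * fcoef s x.
Proof. by rewrite /fcoef big_map mulr_sumr. Qed.

Lemma relations_zmod_closed : zmod_closed relations.
Proof.
split=> [|F F' /asboolP[r Fr] /asboolP[r' Fr']]; apply/asboolP.
  by exists [::] => x; rewrite /fcoef big_nil.
exists (r ++ [seq (- q.1, q.2) | q <- r']) => x.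
rewrite map_cat flatten_cat fcoef_cat -Fr (_ : (F - F') x = F x - F' x) // Fr'; congr (_ + _).
rewrite -map_comp; elim: {Fr'} r' => [|q r' IHr] /=; first by rewrite /fcoef big_nil oppr0.
by rewrite !fcoef_cat opprD IHr !fcoef_tscale mulNr.
Qed.
HB.instance Definition _ := GRing.isZmodClosed.Build _ relations relations_zmod_closed.

(** [T] is the group of all integer functions on [M * B] modulo the relations. The tensor product
    sits inside it as the classes of finitely supported functions, so vanishing in [T] is vanishing
    as a tensor. *)
Lemma tensor_universal : exists (T : zmodType) (f : M -> B -> T),
  balanced f /\ forall s, teval f s = 0 -> tensor_zero phi s.
Proof.
pose K : zmodClosed (M * B -> int) := GRing.ZmodClosed.clone _ relations _.
pose T : zmodType := Quotient.quot K.
pose pi (F : M * B -> int) : T := \pi_T F.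
have piB F F' : pi (F - F') = pi F - pi F' by exact: raddfB.
have pi0 F : relations F <-> pi F = 0.
  rewrite -[F in relations F]subr0 -[relations _]/(F - 0 \in relations) Quotient.idealrBE.
  rewrite (_ : 0 = pi 0); last by rewrite -[0 in RHS](subrr 0) piB subrr.
  by split=> [/eqP|e]; last exact/eqP.
pose f m b := pi (fcoef [:: (1, (m, b))]).
have fE s : teval f s = pi (fcoef s).
  have fcoef_sub x c c' : fcoef [:: (c - c', x)] = fcoef [:: (c, x)] - fcoef [:: (c', x)].
    apply/funext => y; rewrite -[RHS]/(fcoef [:: (c, x)] y - fcoef [:: (c', x)] y).
    by rewrite /fcoef !big_cons !big_nil /=; case: ifP; rewrite ?subr0 ?addr0.
  elim: s => [|[c x] s IHs].
    rewrite /teval big_nil; apply/esym/pi0/asboolP; exists [::] => x.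
    by rewrite /fcoef !big_nil.
  have piZ : pi (fcoef [:: (c, x)]) = pi (fcoef [:: (1, x)]) *~ c.
    pose q c := pi (fcoef [:: (c, x)]).
    have qB : zmod_morphism q by move=> a a'; rewrite /q fcoef_sub piB.
    pose qL : {additive int -> T} := HB.pack q (GRing.isZmodMorphism.Build _ _ q qB).
    by rewrite -[LHS]/(qL c) -[in LHS](intz c) raddfMz.
  rewrite /teval big_cons -/(teval f s) IHs /= {1}/f -surjective_pairing -piZ -raddfD.
  congr pi; apply/funext => y; exact: esym (fcoef_cat [:: (c, x)] s y).
exists T, f; split; last first.
  by move=> s; rewrite fE => /pi0/asboolP.
have rel g : teval f (tgen_expand phi g) = 0.
  rewrite fE; apply/pi0/asboolP; exists [:: (1, g)] => x.
  by rewrite /= cats0 fcoef_tscale mul1r.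
split=> [m m' b|m b b'|a m b].
- have := rel (TAddL m m' b); rewrite /teval !big_cons big_nil /= !mulrN1z mulr1z addr0 -opprD.
  by move/eqP; rewrite subr_eq0 => /eqP.
- have := rel (TAddR m b b'); rewrite /teval !big_cons big_nil /= !mulrN1z mulr1z addr0 -opprD.
  by move/eqP; rewrite subr_eq0 => /eqP.
- have := rel (TBal a m b); rewrite /teval !big_cons big_nil /= !mulrN1z mulr1z addr0.
  by move/eqP; rewrite subr_eq0 => /eqP.
Qed.

End TensorEval.

(** * Tensor products with a localization of the polynomial ring *)

Section Idealization.
Variables (A : comNzRingType) (M : lmodType A).

(** The square-zero extension of [A] by [M]: it makes [M] an ideal of a ring, so that polynomials
    with coefficients in [M] become polynomials over a ring. *)
Definition idealization : Type := (A * M)%type.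
HB.instance Definition _ := GRing.Zmodule.on idealization.

Definition idealization_mul (x y : idealization) : idealization :=
  (x.1 * y.1, x.1 *: y.2 + y.1 *: x.2).

Lemma idealization_mulA : associative idealization_mul.
Proof.
move=> [a m] [b n] [c p]; rewrite /idealization_mul /= mulrA; congr (_, _).
by rewrite !scalerDr !scalerA -!addrA mulrC [c * b]mulrC [c * a]mulrC.
Qed.
Lemma idealization_mulC : commutative idealization_mul.
Proof. by move=> x y; rewrite /idealization_mul mulrC addrC. Qed.
Lemma idealization_mul1 : left_id (1, 0) idealization_mul.
Proof. by move=> [a m]; rewrite /idealization_mul /= mul1r scale1r scaler0 addr0. Qed.
Lemma idealization_mulDl : left_distributive idealization_mul +%R.
Proof.
move=> [a m] [b n] [c p]; rewrite /idealization_mul /= mulrDl scalerDl scalerDr.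
by congr (_, _); rewrite /= addrACA.
Qed.
Lemma idealization_one_neq0 : (1, 0) != 0 :> idealization.
Proof. by apply/eqP => -[/eqP]; rewrite oner_eq0. Qed.
HB.instance Definition _ := GRing.Zmodule_isComNzRing.Build idealization
  idealization_mulA idealization_mulC idealization_mul1 idealization_mulDl idealization_one_neq0.

Definition ideal_scalar (a : A) : idealization := (a, 0).
Definition ideal_vector (m : M) : idealization := (0, m).

Lemma ideal_scalar_zmod_morphism : zmod_morphism ideal_scalar.
Proof. by move=> a b; congr (_, _); rewrite /= subr0. Qed.
HB.instance Definition _ :=
  GRing.isZmodMorphism.Build A idealization ideal_scalar ideal_scalar_zmod_morphism.

Lemma ideal_scalar_monoid_morphism : monoid_morphism ideal_scalar.
Proof. by split=> // a b; congr (_, _); rewrite /= !scaler0 addr0. Qed.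
HB.instance Definition _ :=
  GRing.isMonoidMorphism.Build A idealization ideal_scalar ideal_scalar_monoid_morphism.

Lemma ideal_vector_zmod_morphism : zmod_morphism ideal_vector.
Proof. by move=> m n; congr (_, _); rewrite /= subr0. Qed.
HB.instance Definition _ :=
  GRing.isZmodMorphism.Build M idealization ideal_vector ideal_vector_zmod_morphism.

Lemma ideal_scalarM a m : ideal_scalar a * ideal_vector m = ideal_vector (a *: m).
Proof. by congr (_, _); rewrite /= ?mulr0 // scaler0 addr0. Qed.

End Idealization.

(** * The zero criterion for tensors *)

Section TensorLoc.
Variables (A : comNzRingType) (S : mulset {poly A}).

Definition loc_poly_const : {rmorphism A -> loc S} := toloc S \o polyC.

Variable M : lmodType A.

Definition over_denom (d : denom S) (s : seq (int * (M * {poly A}))) :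
  seq (int * (M * loc S)) := [seq (x.1, (x.2.1, fr x.2.2 d)) | x <- s].

Lemma over_common_denom (s : seq (int * (M * loc S))) :
  exists d s', s = over_denom d s'.
Proof.
have [d dP] := common_denom [seq x.2.2 | x <- s]; exists d.
elim: s dP => [|[c [m b]] s IHs] dP; first by exists [::].
have [|s' ->] := IHs; first by move=> x xs; apply: dP; rewrite inE xs orbT.
have [|p ->] := dP b; first by rewrite inE eqxx.
by exists ((c, (m, p)) :: s').
Qed.

(** The coefficient of X^k in [u] times the element of M[X] represented by [s]. *)
Definition tcoef (u : {poly A}) (s : seq (int * (M * {poly A}))) k : M :=
  \sum_(x <- s) (u * x.2.2)`_k *: x.2.1 *~ x.1.

(** The balanced map [beta] multiplies [m] and [b] inside the localization of E[X]. It sends the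
    tensor to [Q / d], with [Q] the polynomial represented by [s], and a vanishing fraction has its
    numerator killed by a denominator. *)
Lemma tensor_zero_annihilated d s :
  tensor_zero loc_poly_const (over_denom d s) ->
  exists u : denom S, forall k, tcoef (sval u) s k = 0.
Proof.
pose i : {additive M -> idealization M} := @ideal_vector A M.
pose j : {rmorphism A -> idealization M} := @ideal_scalar A M.
pose jX : {rmorphism {poly A} -> {poly idealization M}} := map_poly j.
pose ti m : loc (mulset_image jX S) := toloc _ (i m)%:P.
pose beta m b := ti m * loc_map jX b.
have tiE m : ti m = toloc _ (i m)%:P by [].
have jphi a : loc_map jX (loc_poly_const a) = toloc _ (j a)%:P.
  rewrite /loc_poly_const /= /toloc loc_mapE; apply/fr_eq; exists (denom1 _).
  by rewrite /= map_polyC rmorph1.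
have betaP : balanced loc_poly_const beta.
  split=> [m m' b|m b b'|a m b]; rewrite /beta.
  - by rewrite !tiE raddfD polyCD rmorphD mulrDl.
  - by rewrite rmorphD mulrDr.
  - rewrite rmorphM mulrA; congr (_ * _).
    rewrite [X in _ * X]jphi !tiE -rmorphM -polyCM mulrC ideal_scalarM //.
move=> /(teval_tensor_zero betaP).
rewrite /teval big_map /=.
pose Q := \sum_(x <- s) (i x.2.1)%:P * jX x.2.2 *~ x.1.
rewrite (_ : \sum_(_ <- _) _ = fr Q (denom_map jX d)); last first.
  rewrite frE /Q rmorph_sum mulr_suml; apply: eq_bigr => x _.
  by rewrite /beta loc_mapE [in LHS]frE raddfMz /= rmorphM mulrA mulrzAl.
case/fr_eq0 => -[u' /= /asboolP[u Su ->]] uQ0.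
exists (exist _ u Su) => k /=; suff : i (tcoef u s k) = 0 by case.
have : (jX u * Q)`_k = 0 by rewrite uQ0 coef0.
move=> <-; rewrite /tcoef /Q mulr_sumr coef_sum raddf_sum; apply: eq_bigr => x _.
rewrite mulrzAr mulrCA -rmorphM raddfMz -[RHS]/(coefp k _) raddfMz /= coefCM coef_map /=.
rewrite [ideal_vector _ * _]mulrC.
by rewrite ideal_scalarM.
Qed.

(** After multiplying numerators and denominator by [u] and expanding in powers of X, the tensor is
    the sum over [k] of [tcoef u s k] (x) X^k / (u d). *)
Lemma annihilated_tensor_zero d s (u : denom S) :
  (forall k, tcoef (sval u) s k = 0) ->
  tensor_zero loc_poly_const (over_denom d s).
Proof.
move=> us0; have [T [f [[fDl fDr fZ]]]] := tensor_universal loc_poly_const M; apply.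
have f0l b : f 0 b = 0 by apply: (addIr (f 0 b)); rewrite -fDl !add0r.
have f0r m : f m 0 = 0 by apply: (addIr (f m 0)); rewrite -fDr !add0r.
have fsumr m I r (P : pred I) F : f m (\sum_(i <- r | P i) F i) = \sum_(i <- r | P i) f m (F i).
  by elim/big_rec2: _ => // i _ y _ <-.
have fMz m c b : f (m *~ c) b = f m b *~ c.
  pose q m := f m b.
  have qB : zmod_morphism q.
    by move=> a a'; apply: (addIr (f a' b)); rewrite /q -fDl !subrK.
  pose qL : {additive M -> T} := HB.pack q (GRing.isZmodMorphism.Build _ _ q qB).
  exact: (raddfMz qL).
pose N := (\max_(x <- s) size (sval u * x.2.2)%R)%N.
rewrite /teval big_map /=.
transitivity (\sum_(x <- s) \sum_(k < N)
    f ((sval u * x.2.2)`_k *: x.2.1 *~ x.1) (fr 'X^k (denomM u d))).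
  apply: eq_big_seq => x xs; rewrite -(fr_cancel _ _ u).
  have sN : (size (sval u * x.2.2)%R <= N)%N by exact: (leq_bigmax_seq _ xs).
  rewrite -[in LHS](take_poly_id sN) /take_poly poly_def frE rmorph_sum mulr_suml fsumr.
  rewrite mulrz_suml; apply: eq_bigr => k _; rewrite fMz fZ; congr (f _ _ *~ _).
  by rewrite /loc_poly_const /= !tolocM mulr1 mul_polyC.
rewrite exchange_big big1 // => k _.
have fsuml b : f (tcoef (sval u) s k) b = \sum_(x <- s) f ((sval u * x.2.2)`_k *: x.2.1 *~ x.1) b.
  by rewrite /tcoef; elim/big_rec2: _ => // x y z _ <-.
by rewrite -fsuml us0 f0l.
Qed.

End TensorLoc.

(** * Faithful flatness and injectivity *)

Section PrimitiveExtension.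
Variable A : comNzRingType.
Let S := primitives A.
Let phi := loc_poly_const S.

(** Since [tcoef] commutes with [f], a [u] annihilating the image of the tensor annihilates the
    tensor itself when [f] is injective. *)
Lemma loc_primitives_flat : flat phi.
Proof.
move=> M N f finj s; have [d [s' ->]] := over_common_denom s.
pose fs := [seq (x.1, (f x.2.1, x.2.2)) | x <- s'].
have -> : tmap f (over_denom d s') = over_denom d fs by rewrite /tmap /over_denom -!map_comp.
move=> /tensor_zero_annihilated[u fs0]; apply: (@annihilated_tensor_zero _ _ _ d s' u) => k.
apply: finj; rewrite raddf0 -(fs0 k) /tcoef big_map raddf_sum; apply: eq_bigr => x _.
by rewrite raddfMz /= linearZ.
Qed.

(** If [m] (x) 1 vanishes, all coefficients of some primitive [u] kill [m], so 1 does. *)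
Lemma loc_primitives_faithfully_flat : faithfully_flat phi.
Proof.
split=> [|M M0 m]; first exact: loc_primitives_flat.
have /tensor_zero_annihilated[u um] := M0 (over_denom (denom1 S) [:: (1, (m, 1))]).
pose I (a : A) := a *: m = 0.
suff : I 1 by rewrite /I scale1r.
apply: (primitive_unit (denom_primitive (s := u))); rewrite /I.
- by rewrite scale0r.
- by move=> a b am bm; rewrite scalerDl am bm addr0.
- by move=> a b bm; rewrite -scalerA bm scaler0.
- by move=> k; have := um k; rewrite /tcoef big_cons big_nil addr0 mulr1.
Qed.

Lemma loc_primitives_inj : injective phi.
Proof.
apply: raddf_inj => a /fr_eq0[u ua].
pose I (b : A) := b * a = 0.
suff : I 1 by rewrite /I mul1r.
apply: (primitive_unit (denom_primitive (s := u))); rewrite /I.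
- by rewrite mul0r.
- by move=> b c ba ca; rewrite mulrDl ba ca addr0.
- by move=> b c ca; rewrite -mulrA ca mulr0.
- by move=> k; rewrite -coefMC ua coef0.
Qed.

End PrimitiveExtension.

(* [{poly A}] requires [1 != 0] in [A], so the zero ring is treated apart. *)
Lemma comNzRing_of_nonzero (A : comPzRingType) :
  (1 : A) <> 0 -> exists A' : comNzRingType, A = A' :> comPzRingType.
Proof.
move=> /eqP nz.
exists (HB.pack_for comNzRingType (A : Type) A (GRing.PzSemiRing_isNonZero.Build A nz)).
by case: A nz.
Qed.

Lemma zero_ring_lmod (A : comPzRingType) (M : lmodType A) :
  (1 : A) = 0 -> forall x y : M, x = y.
Proof. by move=> z x y; rewrite -[x]scale1r -[y]scale1r z !scale0r. Qed.

(** Every module over the zero ring is a single point. *)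
Lemma zero_ring_id (A : comPzRingType) : (1 : A) = 0 ->
  faithfully_flat (idfun : {rmorphism A -> A}) /\ Pic_trivial A.
Proof.
move=> z; have Meq := fun M => @zero_ring_lmod A M z.
have Aeq : forall a b : A, a = b := Meq A^o.
split; [split|] => [M N f _ s _|M _ m|M _ _ _].
- have [T [t [[tDl _ _]]]] := tensor_universal (idfun : {rmorphism A -> A}) M; apply.
  rewrite /teval big1 // => x _.
  suff -> : t x.2.1 x.2.2 = 0 by rewrite mul0rz.
  by apply: (addIr (t x.2.1 x.2.2)); rewrite add0r -tDl; congr t; exact: Meq.
- exact: Meq.
- exists (\0 : {linear M -> 'rV[A]_1}); exists (fun=> 0) => x; exact: Meq.
Qed.

Theorem theorem4p2 (A : comPzRingType) :
  exists (B : comPzRingType) (phi : {rmorphism A -> B}),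
    injective phi /\ faithfully_flat phi /\ Pic_trivial B.
Proof.
have [z|/comNzRing_of_nonzero[{}A ->]] := pselect ((1 : A) = 0).
  by exists A, idfun; split; [exact: inj_id | exact: zero_ring_id].
exists (loc (primitives A)), (loc_poly_const (primitives A)); split.
  exact: loc_primitives_inj.
split; [exact: loc_primitives_faithfully_flat | exact: Pic_trivial_primitives].
Qed.
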